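(* Let $Y$ be a dissociated RCE matrix with a fixed AHK representation, let $m,n\ge 1$, and let $h_1$ and $h_2$ be two kernel functions of respective sizes $p_1\times q_1$ and $p_2\times q_2$ with $\mathbb{E}[h_1(Y_{[p_1],[q_1]})^2]<\infty$ and $\mathbb{E}[h_2(Y_{[p_2],[q_2]})^2]<\infty$. (1) Let $(0,0)\le (r_1,c_1)\le (p_1,q_1)$ and $(0,0)\le (r_2,c_2)\le (p_2,q_2)$ be such that $(r_1,c_1)\neq (r_2,c_2)$. Let $(\mathbf{i}_1,\mathbf{j}_1)\in\mathcal{P}_{r_1}([m])\times\mathcal{P}_{c_1}([n])$ and $(\mathbf{i}_2,\mathbf{j}_2)\in\mathcal{P}_{r_2}([m])\times\mathcal{P}_{c_2}([n])$. Then $$\mathrm{Cov}\big(p^{r_1,c_1}h_1(Y_{\mathbf{i}_1,\mathbf{j}_1}),\,p^{r_2,c_2}h_2(Y_{\mathbf{i}_2,\mathbf{j}_2})\big)=0.$$ (2) Let $(r,c)$ be such that $(0,0)\le (r,c)\le (p_1,q_1)$ and $(0,0)\le (r,c)\le (p_2,q_2)$. Let $(\mathbf{i}_1,\mathbf{j}_1)$ and $(\mathbf{i}_2,\mathbf{j}_2)$ be two elements of $\mathcal{P}_r([m])\times\mathcal{P}_c([n])$. If $(\mathbf{i}_1,\mathbf{j}_1)\neq(\mathbf{i}_2,\mathbf{j}_2)$, then $$\mathrm{Cov}\big(p^{r,c}h_1(Y_{\mathbf{i}_1,\mathbf{j}_1}),\,p^{r,c}h_2(Y_{\mathbf{i}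_2,\mathbf{j}_2})\big)=0.$$
   Context: Notation: $\mathbb{N}=\{1,2,\dots\}$, $[n]=\{1,\dots,n\}$, and $\mathcal{P}_k(A)$ is the set of subsets of $A$ of cardinality $k$ (so $\mathcal{P}_0(A)=\{\emptyset\}$). For pairs of integers, $(x,y)\le(x',y')$ means $x\le x'$ and $y\le y'$; $(x,y)<(x',y')$ means in addition $(x,y)\ne(x',y')$. RCE matrices. An infinite real random matrix $Y=(Y_{ij})_{i,j\ge1}$ is row-column exchangeable (RCE) if for all finite permutations $\sigma_1,\sigma_2$ of $\mathbb{N}$, $(Y_{\sigma_1(i)\sigma_2(j)})_{i,j\ge1}$ has the same distribution as $Y$. It is dissociated if for all $m,n$, $(Y_{ij})_{i\le m,j\le n}$ is independent of $(Y_{ij})_{i>m,j>n}$. AHK (Aldous-Hoover-Kallenberg) representation. For a dissociated RCE matrix $Y$ one fixes a measurable function $\phi$ and mutually independent families $(\xi_i)_{i\ge1},(\eta_j)_{j\ge1},(\zeta_{ij})_{i,j\ge1}$ of i.i.d. uniform $[0,1]$ variables with $Y_{ij}=\phi(\xi_i,\eta_j,\zeta_{ij})$ almost surely. For $\mathbf{i},\mathbf{j}\subset\mathbb{N}$, $\mathcal{A}_{\mathbf{i},\mathbf{j}}:=\sigma((\xi_i)_{i\in\mathbf{i}},(\eta_j)_{j\in\mathbf{j}},(\zeta_{ij})_{i\in\mathbf{i},j\in\mathbf{j}})$. Kernels. A kernel function of size $p\times q$ ($p,q\ge1$) is a measurable $h:\mathcal{M}_{p,q}(\mathbb{R})\to\mathbb{R}$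 invariant under permutations of the rows and of the columns of its matrix argument. For $\mathbf{i}\in\mathcal{P}_p(\mathbb{N})$, $\mathbf{j}\in\mathcal{P}_q(\mathbb{N})$, $h(Y_{\mathbf{i},\mathbf{j}})$ is $h$ applied to the submatrix of $Y$ with rows $\mathbf{i}$ and columns $\mathbf{j}$ (in any order). Projections. For $0\le r\le p$, $0\le c\le q$, $\mathbf{i}'\in\mathcal{P}_r(\mathbb{N})$, $\mathbf{j}'\in\mathcal{P}_c(\mathbb{N})$, $\psi^{r,c}h(Y_{\mathbf{i}',\mathbf{j}'}):=\mathbb{E}[h(Y_{\mathbf{i},\mathbf{j}})\mid\mathcal{A}_{\mathbf{i}',\mathbf{j}'}]$ for any $\mathbf{i}\in\mathcal{P}_p(\mathbb{N})$, $\mathbf{j}\in\mathcal{P}_q(\mathbb{N})$ with $\mathbf{i}'\subset\mathbf{i}$, $\mathbf{j}'\subset\mathbf{j}$ (the choice does not matter; this is only a notation, not a function of $Y_{\mathbf{i}',\mathbf{j}'}$, and makes sense also if $\mathbf{i}'$ or $\mathbf{j}'$ is empty). Recursively, $$p^{r,c}h(Y_{\mathbf{i},\mathbf{j}})=\psi^{r,c}h(Y_{\mathbf{i},\mathbf{j}})-\sum_{(0,0)\le(r',c')<(r,c)}\ \sum_{\mathbf{i}'\in\mathcal{P}_{r'}(\mathbf{i}),\,\mathbf{j}'\in\mathcal{P}_{c'}(\mathbf{j})}p^{r',c'}h(Y_{\mathbf{i}',\mathbf{j}'})$$ for $\mathbf{i}\in\mathcal{P}_r(\mathbb{N})$, $\mathbf{j}\in\mathcal{P}_c(\mathbb{N})$;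 in particular $p^{0,0}h=\mathbb{E}[h(Y_{[p],[q]})]$. *)

(* Defs.v *)
From mathcomp Require Import all_boot all_order all_algebra all_fingroup.
From mathcomp Require Import finmap.
From mathcomp Require Import all_classical all_reals all_analysis.
From mathcomp Require Import measurable_realfun.

Set Implicit Arguments.
Unset Strict Implicit.
Unset Printing Implicit Defensive.

Import Order.TTheory GRing.Theory Num.Theory.
Import numFieldNormedType.Exports.

Local Open Scope classical_set_scope.
Local Open Scope ring_scope.

(* Rows and columns of an infinite matrix are indexed by nat from 0, so that
   [m] is {0, ..., m - 1}. *)

Definition initial (m : nat) : {fset nat} := [fset k in iota 0 m]%fset.

Definition ksubsets (k : nat) (A : {fset nat}) : {fset {fset nat}} :=
  [fset B in fpowerset A | #|` B| == k]%fset.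

(* sigma-algebra on S generated by the real functions X k, for k in D *)
Definition sigma_fam (R : realType) (S I : Type) (D : set I) (X : I -> S -> R) :
    set_system S :=
  <<s \bigcup_(k in D) preimage_set_system setT (X k) measurable >>.

(* measurability with respect to a sigma-algebra that is not the canonical one *)
Definition measurable_wrt (R : realType) (S : Type) (G : set_system S)
    (f : S -> R) : Prop :=
  forall B : set R, measurable B -> G (f @^-1` B).

Definition submx_at (R : realType) (T : Type) (Y : nat -> nat -> T -> R)
    (p q : nat) (i j : {fset nat}) (w : T) : 'M[R]_(p, q) :=
  \matrix_(a < p, b < q) Y (nth 0%N (sort leq i) a) (nth 0%N (sort leq j) b) w.

(* h(Y_{i,j}) *)
Definition kernel_at (R : realType) (T : Type) (p q : nat)
    (h : 'M[R]_(p, q) -> R) (Y : nat -> nat -> T -> R) (i j : {fset nat})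
    (w : T) : R :=
  h (submx_at Y p q i j w).

Definition is_kernel (R : realType) (p q : nat) (h : 'M[R]_(p, q) -> R) : Prop :=
  [/\ (0 < p)%N, (0 < q)%N,
      measurable_wrt
        (sigma_fam setT (fun (k : 'I_p * 'I_q) (M : 'M[R]_(p, q)) => M k.1 k.2)) h
    & forall (s : 'S_p) (t : 'S_q) (M : 'M[R]_(p, q)),
        h (row_perm s (col_perm t M)) = h M].

Definition finite_perm (s : nat -> nat) : Prop :=
  bijective s /\ exists N : nat, forall k : nat, (N <= k)%N -> s k = k.

Section Probability.
Context (d : measure_display) (T : measurableType d) (R : realType).
Variable P : probability T R.

Definition same_law (Y Z : nat -> nat -> T -> R) : Prop :=
  forall B : set (nat -> nat -> R),
    sigma_fam setT (fun (k : nat * nat) (M : nat -> nat -> R) => M k.1 k.2) B ->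
    P [set w | B (fun i j => Y i j w)] = P [set w | B (fun i j => Z i j w)].

Definition row_column_exchangeable (Y : nat -> nat -> T -> R) : Prop :=
  forall s1 s2 : nat -> nat, finite_perm s1 -> finite_perm s2 ->
    same_law (fun i j => Y (s1 i) (s2 j)) Y.

Definition independent_systems (F G : set_system T) : Prop :=
  forall A B : set T, F A -> G B -> P (A `&` B) = (P A * P B)%E.

Definition dissociated (Y : nat -> nat -> T -> R) : Prop :=
  forall m n : nat,
    independent_systems
      (sigma_fam [set k : nat * nat | (k.1 < m)%N /\ (k.2 < n)%N]
         (fun k => Y k.1 k.2))
      (sigma_fam [set k : nat * nat | (m <= k.1)%N /\ (n <= k.2)%N]
         (fun k => Y k.1 k.2)).

Definition mutually_independent (I : choiceType) (X : I -> T -> R) : Prop :=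
  forall (J : {fset I}) (B : I -> set R), (forall k, measurable (B k)) ->
    P (\bigcap_(k in [set` J]) (X k @^-1` B k)) =
    (\prod_(k <- J) P (X k @^-1` B k))%E.

Definition uniform01 (X : {RV P >-> R}) : Prop :=
  forall B : set R, measurable B ->
    distribution P X B = uniform_prob (@ltr01 R) B.

Definition ahk_variables (xi eta : nat -> T -> R) (zeta : nat -> nat -> T -> R)
    (k : nat + nat + nat * nat) : T -> R :=
  match k with
  | inl (inl i) => xi i
  | inl (inr j) => eta j
  | inr (i, j) => zeta i j
  end.

Definition ahk_representation (Y : nat -> nat -> {RV P >-> R})
    (phi : R * R * R -> R) (xi eta : nat -> {RV P >-> R})
    (zeta : nat -> nat -> {RV P >-> R}) : Prop :=
  [/\ measurable_fun setT phi,
      [/\ forall i, uniform01 (xi i), forall j, uniform01 (eta j)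
        & forall i j, uniform01 (zeta i j)],
      mutually_independent (ahk_variables xi eta zeta)
    & forall i j, {ae P, forall w, Y i j w = phi (xi i w, eta j w, zeta i j w)}].

Definition ahk_sigma (xi eta : nat -> T -> R) (zeta : nat -> nat -> T -> R)
    (i j : {fset nat}) : set_system T :=
  sigma_fam
    [set k : nat + nat + nat * nat |
      match k with
      | inl (inl a) => a \in i
      | inl (inr b) => b \in j
      | inr (a, b) => (a \in i) && (b \in j)
      end]
    (ahk_variables xi eta zeta).

(* Z is a version of E[X | G] *)
Definition is_condexp (G : set_system T) (X Z : T -> R) : Prop :=
  [/\ measurable_wrt G Z,
      P.-integrable setT (EFin \o Z)
    & forall A : set T, G A ->
        (\int[P]_(w in A) (Z w)%:E = \int[P]_(w in A) (X w)%:E)%E].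

(* psi r c i' j' is the random variable psi^{r,c} h(Y_{i',j'}).  Conditional
   expectations are only defined up to null sets, and the superset (i, j) of
   (i', j') is immaterial: any version, for any one choice of (i, j), is
   accepted. *)
Definition is_psi (Y : nat -> nat -> T -> R) (xi eta : nat -> T -> R)
    (zeta : nat -> nat -> T -> R) (p q : nat) (h : 'M[R]_(p, q) -> R)
    (psi : nat -> nat -> {fset nat} -> {fset nat} -> T -> R) : Prop :=
  forall (r c : nat) (i' j' : {fset nat}),
    (r <= p)%N -> (c <= q)%N -> #|` i'| = r -> #|` j'| = c ->
    exists i j : {fset nat},
      [/\ #|` i| = p, #|` j| = q, (i' `<=` i)%fset, (j' `<=` j)%fset
        & is_condexp (ahk_sigma xi eta zeta i' j')
            (kernel_at h Y i j) (psi r c i' j')].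

End Probability.

Lemma condexp_factor d d' (T : measurableType d) (T' : measurableType d')
    (R : realType) (P : probability T R) (u : {mfun T >-> T'}) (X : T -> R) :
  P.-integrable setT (EFin \o X) ->
  exists f : T' -> R, [/\ measurable_fun setT f,
    P.-integrable setT (EFin \o (f \o u))
  & forall A, measurable A -> (\int[P]_(w in u @^-1` A) (f (u w))%:E =
                              \int[P]_(w in u @^-1` A) (X w)%:E)%E].
Proof.
move=> intX; have mu : measurable_fun setT u by [].
pose P' : {finite_measure set T' -> \bar R} := distribution P u.
pose c : {charge set T' -> \bar R} :=
  measure_function_pushforward__canonical__charge_Charge (induced_charge intX) mu.
have dom : c `<< P'.
  apply: (@dominates_pushforward _ _ _ T' _ P (induced_charge intX)) => //.
  apply/null_content_dominatesP => A mA PA.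
  apply: null_set_integral => //.
  exact: measurable_funS (measurable_int _ intX).
have intf := Radon_Nikodym_integrable dom.
have cE A (mA : measurable A) := Radon_Nikodym_integral dom mA.
have fin x := @Radon_Nikodym_fin_num _ _ _ c P' x dom.
move: (Radon_Nikodym c P') intf cE fin => f intf cE fin.
have fE x : (fine (f x))%:E = f x by rewrite fineK.
have mf : measurable_fun setT f by exact: measurable_int intf.
have intfT : P.-integrable setT (f \o u).
  apply/integrableP; split; first exact: measurableT_comp.
  move/integrableP : intf => [_].
  by rewrite ge0_integral_pushforward//; exact: measurableT_comp.
exists (fine \o f); split.
- by apply: measurableT_comp mf.
- by apply: eq_integrable intfT => // x _ /=; rewrite fE.
- move=> A mA; transitivity (c A); last by [].
  rewrite cE// integral_pushforward//.
    by apply: eq_integral => x _; rewrite /= fE.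
  have mAu : measurable (u @^-1` A).
    by rewrite -[X in measurable X]setTI; exact: measurable_funP.
  exact: integrableS intfT.
Qed.

Lemma condexp_exists d (T : measurableType d) (R : realType)
    (P : probability T R) (G : set_system T) (X : T -> R) :
  sigma_algebra setT G -> G `<=` measurable ->
  P.-integrable setT (EFin \o X) -> exists Z, is_condexp P G X Z.
Proof.
move=> sG Gm intX; pose T' : measurableType _ := g_sigma_algebraType G.
have mE (A : set T) : @measurable _ T' A = G A.
  by rewrite /measurable /= sigma_algebra_id.
have mid : measurable_fun setT (id : T -> T').
  by move=> _ A; rewrite mE setTI => /Gm.
have [f [mf intf fX]] := condexp_factor (mfun_Sub (mem_set mid)) intX.
exists f; split => [B mB||A GA].
- by rewrite -mE -[X in measurable X]setTI; exact: mf.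
- exact: intf.
- by apply: fX; rewrite mE.
Qed.

(* The recursion for p^{r,c} decreases r + c, which k bounds. *)
Fixpoint pproj_rec (R : realType) (T : Type)
    (psi : nat -> nat -> {fset nat} -> {fset nat} -> T -> R)
    (k r c : nat) (i j : {fset nat}) (w : T) : R :=
  psi r c i j w -
  if k is k'.+1 then
    \sum_(r' < r.+1) \sum_(c' < c.+1 | (r' : nat, c' : nat) != (r, c))
      \sum_(i' <- ksubsets r' i) \sum_(j' <- ksubsets c' j)
        pproj_rec psi k' r' c' i' j' w
  else 0.

Definition pproj (R : realType) (T : Type)
    (psi : nat -> nat -> {fset nat} -> {fset nat} -> T -> R)
    (r c : nat) (i j : {fset nat}) (w : T) : R :=
  pproj_rec psi (r + c) r c i j w.

Lemma pprojE (R : realType) (T : Type)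
    (psi : nat -> nat -> {fset nat} -> {fset nat} -> T -> R)
    (r c : nat) (i j : {fset nat}) (w : T) :
  pproj psi r c i j w = psi r c i j w -
    \sum_(r' < r.+1) \sum_(c' < c.+1 | (r' : nat, c' : nat) != (r, c))
      \sum_(i' <- ksubsets r' i) \sum_(j' <- ksubsets c' j)
        pproj psi r' c' i' j' w.
Proof.
have lt (r0 c0 : nat) (r' : 'I_r0.+1) (c' : 'I_c0.+1) :
    (r' : nat, c' : nat) != (r0, c0) -> (r' + c' < r0 + c0)%N.
  have := ltn_ord r'; have := ltn_ord c'; rewrite !ltnS => hc hr.
  rewrite xpair_eqE negb_and => /orP[] ne.
    by rewrite -addSn leq_add// ltn_neqAle ne.
  by rewrite -addnS leq_add// ltn_neqAle ne.
have stab k : forall l r c i j, (r + c <= k)%N -> (r + c <= l)%N ->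
    pproj_rec psi k r c i j w = pproj_rec psi l r c i j w.
  elim: k => [|k IH] [|l] r0 c0 i0 j0 hk hl //=; congr (_ - _).
  - apply/esym/big1 => r' _; apply/big1 => c' /lt.
    by rewrite ltnNge (leq_trans hk).
  - by apply/big1 => r' _; apply/big1 => c' /lt; rewrite ltnNge (leq_trans hl).
  - apply: eq_bigr => r' _; apply: eq_bigr => c' /lt hlt.
    apply: eq_bigr => i' _; apply: eq_bigr => j' _.
    by apply: IH; rewrite -ltnS (leq_trans hlt).
rewrite /pproj (stab (r + c)%N (r + c).+1)//=; congr (_ - _).
apply: eq_bigr => r' _; apply: eq_bigr => c' /lt hlt.
apply: eq_bigr => i' _; apply: eq_bigr => j' _.
by apply: stab => //; exact: ltnW.
Qed.

(* Main.v *)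
(* Write A(i, j) for the sigma-algebra of the AHK variables indexed by (i, j).
   Since A(i, j) and A(i', j') are generated by subfamilies of one independent
   family whose index sets meet in that of (i0, j0) = (i & i', j & j'), an
   A(i, j)-measurable variable with zero conditional expectation given A(i0, j0)
   also has zero conditional expectation given A(i', j').  The recursion says
   that psi(i, j) is the sum of p(a, b) over all a <= i, b <= j, and
   E[psi(i, j) | A(i0, j0)] = psi(i0, j0); so by induction on |i| + |j|,
   E[p(i, j) | A(i', j')] = 0 whenever i <= i', j <= j' fails.  Two distinct pairs
   cannot be included in each other, so for one of the two orders the first
   projection is centered and orthogonal to every square-integrable variable
   measurable for the sigma-algebra of the second. *)
Require Import Defs.
From mathcomp Require Import all_boot all_order all_algebra all_fingroup.
From mathcomp Require Import finmap.
From mathcomp Require Import all_classical all_reals all_analysis.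
From mathcomp Require Import measurable_realfun ring.

Set Implicit Arguments.
Unset Strict Implicit.
Unset Printing Implicit Defensive.

Import Order.TTheory GRing.Theory Num.Theory.
Import numFieldNormedType.Exports.

Local Open Scope classical_set_scope.
Local Open Scope ring_scope.

(** * Generated sigma-algebras *)

Section SigmaFam.
Context (R : realType) (S I : Type).
Implicit Types (D E : set I) (X : I -> S -> R) (G : set_system S).

Lemma sigma_fam_sigma_algebra D X : sigma_algebra setT (sigma_fam D X).
Proof. exact: smallest_sigma_algebra. Qed.

Lemma sigma_fam_gen D X k (B : set R) :
  D k -> measurable B -> sigma_fam D X (X k @^-1` B).
Proof.
move=> Dk mB; apply: sub_sigma_algebra; exists k => //.
by exists B => //; rewrite setTI.
Qed.

(** Serves as an induction principle: a property of sets that defines a sigma-algebra and holds for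
    the generators holds on all of [sigma_fam D X]. *)
Lemma sigma_fam_sub D X G : sigma_algebra setT G ->
  (forall k (B : set R), D k -> measurable B -> G (X k @^-1` B)) ->
  sigma_fam D X `<=` G.
Proof.
move=> sG DG; apply: smallest_sub => // A [k Dk [B mB <-]].
by rewrite setTI; exact: DG.
Qed.

Lemma sigma_famS D E X : D `<=` E -> sigma_fam D X `<=` sigma_fam E X.
Proof.
move=> DE; apply: sigma_fam_sub; first exact: sigma_fam_sigma_algebra.
by move=> k B /DE Ek mB; exact: sigma_fam_gen.
Qed.

End SigmaFam.

(** * Finite-dimensional cylinders *)

Section Cylinders.
Context (R : realType) (S : pointedType) (I : choiceType).
Implicit Types (D E : set I) (X : I -> S -> R) (G : set_system S).

(** [B] is defined on all of [I] and [J] selects the constraints in force, which is the shape used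
    by [mutually_independent]. *)
Definition cylinders D X : set_system S :=
  [set C | exists J : {fset I}, exists2 B : I -> set R,
     forall k, measurable (B k) &
     [set` J] `<=` D /\ C = \bigcap_(k in [set` J]) (X k @^-1` B k)].

Lemma cylindersI D X : setI_closed (cylinders D X).
Proof.
move=> _ _ [J1 [B1 mB1 [J1D ->]]] [J2 [B2 mB2 [J2D ->]]].
(* The values of [B1] outside [J1], and of [B2] outside [J2], are arbitrary, so they are replaced by
   [setT]. *)
exists (J1 `|` J2)%fset, (fun k => (if k \in J1 then B1 k else setT) `&`
                              (if k \in J2 then B2 k else setT)).
  by move=> k; apply: measurableI; case: ifP.
split=> [k /=|]; first by rewrite inE => /orP[/J1D|/J2D].
apply/seteqP; split=> w /=.
- move=> [w1 w2] k _ /=; split; case: ifPn => // kJ; [exact: w1|exact: w2].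
- move=> w12; split=> k /= kJ.
  + by have [|] := w12 k; rewrite /= ?inE kJ.
  + by have [|_] := w12 k; rewrite /= ?inE kJ ?orbT.
Qed.

Lemma cylindersT D X : cylinders D X setT.
Proof.
exists fset0, (fun=> setT) => //; split=> [k /=|]; first by rewrite inE.
by apply/esym; rewrite -subTset => w _ k.
Qed.

(** Trades the one-coordinate generators for a class stable under intersection, as required by
    Dynkin's argument and by the uniqueness of measures. *)
Lemma sigma_fam_cylinders D X : sigma_fam D X = <<s cylinders D X >>.
Proof.
apply/seteqP; split.
  apply: sigma_fam_sub => [|k B Dk mB]; first exact: smallest_sigma_algebra.
  apply: sub_sigma_algebra; exists [fset k]%fset, (fun=> B) => //; split.
    by move=> l /=; rewrite inE => /eqP ->.
  apply/seteqP; split=> w /= => [wB l /=|]; first by rewrite inE => /eqP ->.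
  by apply => /=; rewrite inE.
apply: smallest_sub; first exact: sigma_fam_sigma_algebra.
move=> _ [J [B mB [JD ->]]].
apply: (@fin_bigcap_measurable _ (g_sigma_algebraType
  (\bigcup_(k in D) preimage_set_system setT (X k) measurable))).
  exact: finite_fset.
by move=> k kJ; apply: sigma_fam_gen (mB k); exact: JD.
Qed.

(** Makes the closure properties of measurable functions available for [G], by taking [G] as the
    canonical sigma-algebra of a copy of [S]. *)
Lemma measurable_wrtP G (sG : sigma_algebra setT G) (f : S -> R) :
  measurable_wrt G f <-> measurable_fun setT (f : g_sigma_algebraType G -> R).
Proof.
have mE (A : set S) : @measurable _ (g_sigma_algebraType G) A = G A.
  by rewrite /measurable /= sigma_algebra_id.
split=> [mf _ B mB|mf B mB]; first by rewrite setTI mE; exact: mf.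
by rewrite -mE -[X in measurable X]setTI; exact: mf.
Qed.

End Cylinders.

(** * Vanishing conditional expectations *)

Section NullOn.
Context d (T : measurableType d) (R : realType) (P : probability T R).
Implicit Types (G : set_system T) (D U : T -> R).
Import HBNNSimple.

(* E[D | G] = 0 *)
Definition null_on G D : Prop :=
  forall A, G A -> (\int[P]_(w in A) (D w)%:E = 0)%E.

Lemma integral_mul_indic A D : measurable A ->
  (\int[P]_w (D w * \1_A w)%:E = \int[P]_(w in A) (D w)%:E)%E.
Proof.
move=> mA; rewrite [RHS]integral_mkcond; apply: eq_integral => w _.
rewrite patchE indicE; case: ifP => wA; by rewrite ?mulr1 ?mulr0.
Qed.

Lemma integrable_mul_indic A D : measurable A ->
  P.-integrable setT (EFin \o D) ->
  P.-integrable setT (fun w => (D w * \1_A w)%:E).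
Proof.
move=> mA iD; apply: le_integrable (iD) => //.
  apply/measurable_EFinP; apply: measurable_funM => //.
  by apply/measurable_EFinP; exact: measurable_int iD.
move=> w _; rewrite /= lee_fin normrM ler_piMr// indicE.
by case: (w \in A); rewrite ?normr1 ?normr0.
Qed.

(** A simple function for [G] is a finite combination of indicators of its level sets; these lie in
    [G], and [D] integrates to zero over each. *)
Lemma null_on_mul_nnsfun G D (g : {nnsfun (g_sigma_algebraType G) >-> R}) :
  sigma_algebra setT G -> G `<=` measurable ->
  P.-integrable setT (EFin \o D) -> null_on G D ->
  (\int[P]_w (D w * g w)%:E = 0)%E.
Proof.
move=> sG Gm iD D0.
have Gg y : G (g @^-1` [set y]).
  have : measurable (g @^-1` [set y]) by exact: measurable_sfunP.
  by rewrite /measurable/= sigma_algebra_id.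
have E w : (D w * g w)%:E = (\sum_(y <- fset_set (range g))
    y%:E * (D w * \1_(g @^-1` [set y]) w)%:E)%E.
  rewrite fimfunE fsbig_finite//= mulr_sumr -sumEFin.
  by apply: eq_bigr => y _; rewrite -EFinM mulrCA.
under eq_integral do rewrite E.
have iDi y := integrable_mul_indic (Gm _ (Gg y)) iD.
rewrite integral_sum//=; last by move=> y; exact: integrableZl.
by rewrite big1// => y _; rewrite integralZl// integral_mul_indic ?D0 ?mule0//;
  exact: Gm.
Qed.

(** Simple functions for [G] approximate [U] from below; dominated convergence with bound [|D * U|]
    passes to the limit of integrals that all vanish. *)
Lemma null_on_mul_ge0 G D U :
  sigma_algebra setT G -> G `<=` measurable ->
  P.-integrable setT (EFin \o D) -> null_on G D ->
  measurable_wrt G U -> (forall w, 0 <= U w) ->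
  P.-integrable setT (fun w => (D w * U w)%:E) ->
  (\int[P]_w (D w * U w)%:E = 0)%E.
Proof.
move=> sG Gm iD D0 GU U0 iDU.
pose T' := g_sigma_algebraType G.
have mU : measurable_fun [set: T'] (EFin \o U).
  by apply/measurable_EFinP; exact/measurable_wrtP.
pose g := nnsfun_approx measurableT mU.
have gU n w : g n w <= U w.
  rewrite /g nnsfun_approxE -lee_fin.
  by apply: (@le_approx _ _ _ setT) => // x _; rewrite lee_fin.
have mD : measurable_fun setT D.
  by apply/measurable_EFinP; exact: measurable_int iD.
have mg n : measurable_fun [set: T] (g n).
  move=> _ B mB; rewrite setTI; apply: Gm.
  have : measurable (g n @^-1` B) by exact: measurable_sfunP.
  by rewrite /measurable/= sigma_algebra_id.
have [] := @dominated_convergence _ _ _ P setT measurableT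
  (fun n w => (D w * g n w)%:E) (fun w => (D w * U w)%:E)
  (fun w => `|(D w * U w)%:E|)%E.
- by move=> n; apply/measurable_EFinP; exact: measurable_funM.
- exact: measurable_int iDU.
- apply: aeW => w _; apply: cvg_EFin; first exact: nearW.
  apply: cvgMr => //.
  have := @cvg_nnsfun_approx _ T' _ setT measurableT (EFin \o U) mU
    (fun x _ => U0 x) w I.
  by move/fine_cvg.
- exact: integrable_abse.
- apply: aeW => w n _; rewrite lee_fin !normrM ler_wpM2l// !ger0_norm//.
move=> _ _; under eq_fun do rewrite null_on_mul_nnsfun//.
by move/cvg_lim => <-//; rewrite lim_cst.
Qed.

(** The positive and negative parts of [U] are bounded by [|U|], so their products with [D] stay
    integrable and the nonnegative case applies to each. *)
Lemma null_on_mul G D U :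
  sigma_algebra setT G -> G `<=` measurable ->
  P.-integrable setT (EFin \o D) -> null_on G D ->
  measurable_wrt G U ->
  P.-integrable setT (fun w => (D w * U w)%:E) ->
  (\int[P]_w (D w * U w)%:E = 0)%E.
Proof.
move=> sG Gm iD D0 GU iDU.
have mD : measurable_fun setT D.
  by apply/measurable_EFinP; exact: measurable_int iD.
have GV (f : R -> R) : measurable_fun setT f -> measurable_wrt G (f \o U).
  move=> mf B mB; rewrite comp_preimage; apply: GU.
  by rewrite -[X in measurable X]setTI; exact: mf.
have iV (f : R -> R) : measurable_fun setT f -> (forall x, `|f x| <= `|x|) ->
    P.-integrable setT (fun w => (D w * f (U w))%:E).
  move=> mf fU; apply: le_integrable (iDU) => //.
    apply/measurable_EFinP; apply: measurable_funM => // _ B mB.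
    by rewrite setTI; apply: Gm; exact: GV.
  by move=> w _; rewrite lee_fin !normrM ler_wpM2l.
pose pos (x : R) := Num.max x 0; pose neg (x : R) := Num.max (- x) 0.
have mpos : measurable_fun setT pos by exact: measurable_maxr.
have mneg : measurable_fun setT neg.
  by apply: measurable_maxr => //; exact: measurable_funN.
have bpos x : `|pos x| <= `|x| by rewrite /pos /Num.max; case: ifP; rewrite ?normr0.
have bneg x : `|neg x| <= `|x|.
  by rewrite /neg /Num.max; case: ifP; rewrite ?normr0 ?normrN.
have E w : (D w * U w)%:E = ((D w * pos (U w))%:E - (D w * neg (U w))%:E)%E.
  rewrite -EFinB -mulrBr; congr (_ * _)%:E.
  rewrite /pos /neg /Num.max oppr_lt0.
  by case: (ltgtP (U w) 0) => [||->]; rewrite ?subr0 ?sub0r ?opprK ?oppr0.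
under eq_integral do rewrite E.
rewrite integralB//; [|exact: iV..].
have f0 (f : R -> R) : measurable_fun setT f -> (forall x, `|f x| <= `|x|) ->
    (forall x, 0 <= f x) -> (\int[P]_w (D w * f (U w))%:E = 0)%E.
  move=> mf fU f0; apply: null_on_mul_ge0 sG Gm iD D0 (GV f mf) _ _ => //.
  - by move=> w; exact: f0.
  - exact: iV.
by rewrite !f0 ?sube0// => x; rewrite le_max lexx orbT.
Qed.

End NullOn.

(** * Square integrability of conditional expectations *)

Section SquareIntegrable.
Context d (T : measurableType d) (R : realType) (P : probability T R).
Implicit Types (G : set_system T) (X Z : T -> R).

Lemma Lfun2P X : X \in Lfun P 2%:E <->
  measurable_fun setT X /\ (\int[P]_w (X w ^+ 2)%:E < +oo)%E.
Proof.
split=> [LX|[mX X2]].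
  split; first by move: LX; rewrite inE => /andP[]; rewrite inE.
  exact/integrable_lty/Lfun2_integrable_sqr.
rewrite inE; apply/andP; split; rewrite inE//=.
rewrite /finite_norm unlock/= poweR_lty//.
under eq_integral => w _ do rewrite powR_mulrn// real_normK ?num_real//.
exact: X2.
Qed.

Lemma Lfun2_integrable X : X \in Lfun P 2%:E -> P.-integrable setT (EFin \o X).
Proof.
move=> LX; apply/Lfun1_integrable; apply: Lfun_subset12 LX.
exact: fin_num_measure.
Qed.

(* With f the truncation of Z at level n, E[(X - Z) f] = 0 and
   f ^ 2 + 2 (X - Z) f <= X ^ 2, hence E[f ^ 2] <= E[X ^ 2]; let n tend to infinity. *)
Lemma condexp_Lfun2 G X Z : sigma_algebra setT G -> G `<=` measurable ->
  X \in Lfun P 2%:E -> is_condexp P G X Z -> Z \in Lfun P 2%:E.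
Proof.
move=> sG Gm LX [GZ iZ ZX].
have [mX X2] := (Lfun2P X).1 LX.
have iX := Lfun2_integrable LX.
have mZ : measurable_fun setT Z by apply/measurable_EFinP; exact: measurable_int iZ.
have XZ0 : null_on P G (X \- Z).
  move=> A GA; rewrite /=.
  under eq_integral do rewrite EFinB.
  have iXA : P.-integrable A (EFin \o X).
    by apply: integrableS iX => //; exact: Gm.
  have iZA : P.-integrable A (EFin \o Z).
    by apply: integrableS iZ => //; exact: Gm.
  rewrite integralB//; last exact: Gm.
  by rewrite ZX// subee// -/(EFin \o X) integrable_fin_num//; exact: Gm.
(* Values beyond the level are sent to zero rather than clamped: where [f n] vanishes the bound by
   [X ^+ 2] is trivial, and elsewhere the gap is exactly [(X - Z) ^+ 2]. *)
pose f n (x : R) := x * \1_(`[- n%:R, n%:R] : set R) x.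
have mf n : measurable_fun setT (f n) by exact: measurable_funM.
have fE n x : f n x = if `|x| <= n%:R then x else 0.
  rewrite /f indicE mem_setE in_itv/= -ler_norml.
  by case: ifP; rewrite ?mulr1 ?mulr0.
have fle n x : `|f n x| <= n%:R by rewrite fE; case: ifP => //; rewrite normr0.
have mfZ n : measurable_fun setT (fun w => f n (Z w)).
  by apply: measurableT_comp.
have i2 n : P.-integrable setT (fun w => (f n (Z w) ^+ 2)%:E).
  have : P.-integrable setT (EFin \o cst (n%:R ^+ 2 : R)).
    exact: finite_measure_integrable_cst.
  apply: le_integrable => //.
    by apply/measurable_EFinP; exact: measurable_funX.
  move=> w _; rewrite /= lee_fin !normrX; apply: lerXn2r; rewrite ?nnegrE//.
  by rewrite [leRHS]ger0_norm.
have iXZ : P.-integrable setT (EFin \o (X \- Z)).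
  exact: (integrableB measurableT iX iZ).
have key n : (\int[P]_w (f n (Z w) ^+ 2)%:E <= \int[P]_w (X w ^+ 2)%:E)%E.
  have iXZf : P.-integrable setT (fun w => ((X \- Z) w * f n (Z w))%:E).
    have : P.-integrable setT (fun w => (n%:R)%:E * ((X w - Z w)%:E))%E.
      exact: integrableZl.
    apply: le_integrable => //.
      by apply/measurable_EFinP; apply: measurable_funM => //; exact: measurable_funB.
    move=> w _; rewrite /= lee_fin normrM mulrC [leRHS]normrM ler_wpM2r//.
    by rewrite [leRHS]ger0_norm.
  have z0 : (\int[P]_w ((X \- Z) w * f n (Z w))%:E = 0)%E.
    apply: (@null_on_mul _ _ _ P G (X \- Z) (fun w => f n (Z w))) => // B mB.
    have := GZ (f n @^-1` B); apply; rewrite -[X in measurable X]setTI; exact: mf.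
  have -> : (\int[P]_w (f n (Z w) ^+ 2)%:E =
      \int[P]_w ((f n (Z w) ^+ 2)%:E + 2%:E * ((X \- Z) w * f n (Z w))%:E))%E.
    by rewrite integralD//; [rewrite integralZl// z0 mule0 adde0|exact: integrableZl].
  apply: le_integral => //.
  - by apply: integrableD => //; exact: integrableZl.
  - exact: Lfun2_integrable_sqr.
  - move=> w _; rewrite -EFinM -EFinD lee_fin /= fE; case: ifP => _; last first.
      by rewrite expr0n/= mulr0 mulr0 addr0 sqr_ge0.
    rewrite -subr_ge0.
    have -> : X w ^+ 2 - (Z w ^+ 2 + 2 * ((X w - Z w) * Z w)) = (X w - Z w) ^+ 2.
      by ring.
    exact: sqr_ge0.
apply/Lfun2P; split=> //; apply: le_lt_trans ((Lfun2P X).1 LX).2.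
(* At a fixed point the truncation does nothing once the level exceeds [|Z w|], so the sequence is
   eventually constant. *)
have Zlim w : (Z w ^+ 2)%:E = limn (fun n => (f n (Z w) ^+ 2)%:E).
  apply/esym/cvg_lim => //; apply: cvg_near_cst.
  near=> n; rewrite fE ifT//; near: n; exact: nbhs_infty_ger.
under eq_integral do rewrite Zlim.
have nd w : nondecreasing_seq (fun n => (f n (Z w) ^+ 2)%:E).
  move=> a b ab; rewrite lee_fin !fE; case: ifPn => [Za|_].
    by rewrite (le_trans Za)// ler_nat.
  by rewrite expr0n/= sqr_ge0.
have mf2 n : measurable_fun setT (fun w => (f n (Z w) ^+ 2)%:E).
  exact: measurable_int (i2 n).
have ge0 n w : (0 <= (f n (Z w) ^+ 2)%:E)%E by rewrite lee_fin sqr_ge0.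
rewrite monotone_convergence//.
apply: lime_le; last exact: nearW.
apply: ereal_nondecreasing_is_cvgn => a b ab; apply: ge0_le_integral => // w _.
exact: nd.
Unshelve. all: by end_near. Qed.

End SquareIntegrable.

(** * Independence and vanishing conditional expectations *)

Section Independence.
Context d (T : measurableType d) (R : realType) (P : probability T R).

(** Dynkin's argument: the sets over which [D] integrates to zero are stable under countable
    disjoint unions and, because [setT] is in [C], under complement. *)
Lemma null_on_generated (C : set_system T) (D : T -> R) : setI_closed C -> C setT ->
  C `<=` measurable -> P.-integrable setT (EFin \o D) ->
  null_on P C D -> null_on P <<s C >> D.
Proof.
move=> CI CT Cm iD C0.
have Gm : <<s C >> `<=` measurable.
  by apply: smallest_sub => //; exact: sigma_algebra_measurable.
have iDA A : measurable A -> P.-integrable A (EFin \o D).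
  by move=> mA; exact: integrableS iD.
apply: (@dynkin_induction _ (g_sigma_algebraType C) C
  (fun A : set T => (\int[P]_(w in A) (D w)%:E = 0)%E)) => //.
- exact: C0.
- move=> A /Gm mA A0.
  have : (\int[P]_(w in A `|` ~` A) (D w)%:E = 0)%E by rewrite setUv; exact: C0.
  rewrite integral_setU//; [|exact: measurableC| |].
  + by rewrite A0 add0e.
  + exact/measurable_funTS/(measurable_int P).
  + by rewrite disj_set2E setICr.
- move=> F mF tF F0; rewrite integral_bigcup//.
  + by rewrite eseries0.
  + by move=> k; apply: Gm; exact: mF.
  + by apply: iDA; apply: bigcup_measurable => k _; apply: Gm; exact: mF.
Qed.

Context (I : choiceType) (W : I -> T -> R).
Hypothesis mW : forall k, measurable_fun setT (W k).
Hypothesis indW : mutually_independent P W.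
Implicit Types (E F : set I).

Lemma sigma_fam_measurable E : sigma_fam E W `<=` measurable.
Proof.
apply: sigma_fam_sub; first exact: sigma_algebra_measurable.
by move=> k B _ mB; rewrite -[X in measurable X]setTI; exact: mW.
Qed.

Lemma cylinders_sigma_fam E : cylinders E W `<=` sigma_fam E W.
Proof. by rewrite sigma_fam_cylinders; exact: sub_sigma_algebra. Qed.

(** As [J1] and [J2] are disjoint, the two cylinders meet in a single one over their union, and its
    probability is a product that splits along [J1]. *)
Lemma independent_cylinders E F : E `&` F = set0 ->
  independent_systems P (cylinders E W) (cylinders F W).
Proof.
move=> EF0 _ _ [J1 [B1 mB1 [J1E ->]]] [J2 [B2 mB2 [J2F ->]]].
have J21 k : k \in J2 -> (k \in J1) = false.
  move=> k2; apply/negP => k1.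
  suff : (E `&` F) k by rewrite EF0.
  by split; [exact: J1E|exact: J2F].
have E12 : (\bigcap_(k in [set` J1]) (W k @^-1` B1 k)) `&`
    (\bigcap_(k in [set` J2]) (W k @^-1` B2 k)) =
    \bigcap_(k in [set` (J1 `|` J2)%fset])
       (W k @^-1` (if k \in J1 then B1 k else B2 k)).
  apply/seteqP; split=> w /=.
  - move=> [w1 w2] k /=; rewrite inE.
    by case: ifPn => [k1 _|_ /= k2]; [exact: w1|exact: w2].
  - move=> w12; split=> k /= kJ; have := w12 k; rewrite /= inE kJ ?orbT.
    + exact.
    + by rewrite J21//; exact.
rewrite E12 !indW//; last by move=> k; case: ifP.
rewrite (big_fsetID _ (mem J1))/=; congr (_ * _)%E.
- apply: eq_fbig => k; last by rewrite !inE/= => /andP[_ ->].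
  by rewrite !inE/=; case: (k \in J1); rewrite ?andbF.
- apply: eq_fbig => k; last by rewrite !inE/= => /andP[_ /negbTE ->].
  rewrite !inE/=; have := @J21 k; case: (k \in J2) => [->//|_].
  by case: (k \in J1).
Qed.

(* On a cylinder over F, split into cylinders C1 over E & F and C2 over F \ E:
   as C2 is independent of the family E, the integral of V on C1 & C2 is
   P C2 times the integral of V on C1. *)
Lemma null_on_setI E F (V : T -> R) :
  measurable_wrt (sigma_fam E W) V -> P.-integrable setT (EFin \o V) ->
  null_on P (sigma_fam (E `&` F) W) V -> null_on P (sigma_fam F W) V.
Proof.
move=> EV iV V0; rewrite sigma_fam_cylinders; apply: null_on_generated => //.
- exact: cylindersI.
- exact: cylindersT.
- by move=> A /cylinders_sigma_fam/sigma_fam_measurable.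
move=> _ [J [B mB [JF ->]]].
pose cyl (J' : {fset I}) := \bigcap_(k in [set` J']) (W k @^-1` B k).
pose J1 := [fset k in J | k \in E]%fset; pose J2 := [fset k in J | k \notin E]%fset.
have J1EF : cylinders (E `&` F) W (cyl J1).
  exists J1, B => //; split=> // k /=; rewrite !inE/= => /andP[kJ].
  by rewrite inE => kE; split=> //; exact: JF.
have J2E : cylinders (~` E) W (cyl J2).
  exists J2, B => //; split=> // k /=; rewrite !inE/= => /andP[kJ].
  by rewrite notin_setE.
have mJ1 := sigma_fam_measurable (cylinders_sigma_fam J1EF).
have mJ2 := sigma_fam_measurable (cylinders_sigma_fam J2E).
have -> : \bigcap_(k in [set` J]) (W k @^-1` B k) = cyl J1 `&` cyl J2.
  apply/seteqP; split=> w /=.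
  - by move=> wJ; split=> k /=; rewrite !inE/= => /andP[kJ _]; exact: wJ.
  - move=> [w1 w2] k /= kJ; case: (boolP (k \in E)) => kE.
    + by apply: w1; rewrite /= !inE/= kJ.
    + by apply: w2; rewrite /= !inE/= kJ.
rewrite -integral_mul_indic; last exact: measurableI.
pose p := fine (P (cyl J2)).
have pE : p%:E = P (cyl J2) by rewrite fineK// fin_num_measure.
(* The centered indicator of [cyl J2] has zero conditional expectation given the family [E], so it
   is orthogonal to [V] times the indicator of [cyl J1]; expanding this product gives the announced
   factorization. *)
pose D w : R := \1_(cyl J2) w - p.
have i2 : P.-integrable setT (fun w => (\1_(cyl J2) w)%:E).
  exact: integrable_indic.
have ip : P.-integrable setT (EFin \o cst p).
  exact: finite_measure_integrable_cst.
have iD : P.-integrable setT (EFin \o D) by exact: (integrableB measurableT i2 ip).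
have D0 : null_on P (sigma_fam E W) D.
  rewrite sigma_fam_cylinders; apply: null_on_generated => //.
  - exact: cylindersI.
  - exact: cylindersT.
  - by move=> A /cylinders_sigma_fam/sigma_fam_measurable.
  move=> A EA; have mA := sigma_fam_measurable (cylinders_sigma_fam EA).
  under eq_integral do rewrite EFinB.
  rewrite integralB//; [|exact: integrableS i2|exact: integrableS ip].
  rewrite integral_indic// integral_cst// pE muleC setIC.
  rewrite [X in (X - _)%E](independent_cylinders (setICr E) EA J2E).
  by rewrite subee// fin_numM// fin_num_measure.
have iV1 : P.-integrable setT (fun w => (V w * \1_(cyl J1) w)%:E).
  exact: integrable_mul_indic.
have iV12 : P.-integrable setT (fun w => (V w * \1_(cyl J1) w * \1_(cyl J2) w)%:E).
  exact: integrable_mul_indic iV1.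
have Eip : P.-integrable setT (fun w => (D w * (V w * \1_(cyl J1) w))%:E).
  have := integrableB measurableT iV12 (integrableZl measurableT p iV1).
  apply: eq_integrable => // w _.
  by rewrite -EFinM -EFinB /D mulrBl [in RHS]mulrC.
have EV1 : measurable_wrt (sigma_fam E W) (fun w => V w * \1_(cyl J1) w).
  have sE := @sigma_fam_sigma_algebra R T I E W.
  apply/(measurable_wrtP sE); apply: measurable_funM.
    exact/measurable_wrtP.
  apply: measurable_indic; rewrite measurable_g_measurableTypeE//.
  apply: sigma_famS (cylinders_sigma_fam J1EF).
  exact: subIsetl.
have := null_on_mul (sigma_fam_sigma_algebra E W) (@sigma_fam_measurable E)
  iD D0 EV1 Eip.
have Ed w : (D w * (V w * \1_(cyl J1) w))%:E =
  ((V w * \1_(cyl J1) w * \1_(cyl J2) w)%:E - p%:E * (V w * \1_(cyl J1) w)%:E)%E.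
  by rewrite -EFinM -EFinB /D mulrBl; congr (_ - _)%:E; rewrite mulrC.
under eq_integral do rewrite Ed.
rewrite integralB//; last exact: integrableZl.
have V1 : (\int[P]_w (V w * \1_(cyl J1) w)%:E = 0)%E.
  by rewrite integral_mul_indic//; apply: V0; exact: cylinders_sigma_fam.
rewrite integralZl// V1 mule0 sube0.
by move=> <-; apply: eq_integral => w _; rewrite indicI mulrA.
Qed.

End Independence.

(** * Exchangeability of the AHK variables *)

Section Relabel.
Context d (T : measurableType d) (R : realType) (P : probability T R).
Context (I : choiceType) (W : I -> T -> R).
Hypothesis mW : forall k, measurable_fun setT (W k).
Hypothesis indW : mutually_independent P W.

Let coords (k : I) (M : I -> R) : R := M k.
Let C := cylinders setT coords.
(** The space of sample families with its product sigma-algebra, on which the joint law of [W]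
    lives. *)
Let T2 := g_sigma_algebraType C.

Lemma measurable_sample (V : I -> T -> R) : (forall k, measurable_fun setT (V k)) ->
  measurable_fun setT (fun w => V^~ w : T2).
Proof.
move=> mV; apply: (@measurability _ _ T T2 setT _ C) => // _ [_ [J [B mB [_ ->]]] <-].
rewrite setTI preimage_bigcap; apply: fin_bigcap_measurable; first exact: finite_fset.
by move=> k _; rewrite -[X in measurable X]setTI; exact: (mV k _ _ (mB k)).
Qed.

(** By independence, both laws give a cylinder the same product of marginal probabilities; cylinders
    determine a probability measure. *)
Lemma relabel_law (s t : I -> I) : cancel s t -> cancel t s ->
  (forall k (B : set R), measurable B -> P (W (s k) @^-1` B) = P (W k @^-1` B)) ->
  forall A : set T2, measurable A ->
    P ((fun w => (fun k => W k w) : T2) @^-1` A) =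
    P ((fun w => (fun k => W (s k) w) : T2) @^-1` A).
Proof.
move=> st ts Ws A mA.
have mW1 := measurable_sample mW.
have mW2 : measurable_fun setT (fun w => (fun k => W (s k) w) : T2).
  exact: measurable_sample.
apply: (@measure_unique _ R T2 C (fun=> setT) _ _ _ _
  (pushforward P (fun w => (fun k => W k w) : T2))
  (pushforward P (fun w => (fun k => W (s k) w) : T2))) => //.
- exact: cylindersI.
- by move=> _; exact: cylindersT.
- by rewrite bigcup_const.
- move=> _ [J [B mB [_ ->]]].
  transitivity (P (\bigcap_(k in [set` J]) (W k @^-1` B k))); first by [].
  transitivity (P (\bigcap_(k in [set` J]) (W (s k) @^-1` B k))); last by [].
  (* The relabelled cylinder constrains the image of [J] under [s], with its bounds read back
     through the inverse [t]. *)
  have -> : \bigcap_(k in [set` J]) (W (s k) @^-1` B k) =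
      \bigcap_(l in [set` (s @` J)%fset]) (W l @^-1` B (t l)).
    apply/seteqP; split=> w /= wJ k /= kJ.
      by move/imfsetP : kJ => [l /= lJ ->]; rewrite st; exact: wJ.
    by have := wJ (s k); rewrite /= st; apply; exact: in_imfset.
  rewrite !indW// big_imfset/=; last by move=> k l _ _; exact: (can_inj st).
  by apply: eq_bigr => k _; rewrite st Ws.
- by move=> _; rewrite [ltLHS](_ : _ = P setT)// probability_setT ltry.
Qed.

(** The nonnegative version, through which second moments are compared before integrability is
    established. *)
Lemma relabel_integral_ge0 (s t : I -> I) (F : T2 -> \bar R) :
  cancel s t -> cancel t s ->
  (forall k (B : set R), measurable B -> P (W (s k) @^-1` B) = P (W k @^-1` B)) ->
  measurable_fun setT F -> (forall M, (0 <= F M)%E) ->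
  (\int[P]_w F (W^~ w) = \int[P]_w F (fun k => W (s k) w))%E.
Proof.
move=> st ts Ws mF F0.
have mW1 := measurable_sample mW.
have mW2 : measurable_fun setT (fun w => (fun k => W (s k) w) : T2).
  exact: measurable_sample.
rewrite -[LHS](@ge0_integral_pushforward _ _ _ _ _ _ mW1 P setT)//.
rewrite -[RHS](@ge0_integral_pushforward _ _ _ _ _ _ mW2 P setT)//.
by apply: eq_measure_integral => A mA _; exact: (relabel_law st ts Ws).
Qed.

Lemma relabel_integral (s t : I -> I) (F : T2 -> \bar R) (A : set T2) :
  cancel s t -> cancel t s ->
  (forall k (B : set R), measurable B -> P (W (s k) @^-1` B) = P (W k @^-1` B)) ->
  measurable_fun setT F -> measurable A ->
  P.-integrable setT (fun w => F (W^~ w)) ->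
  P.-integrable setT (fun w => F (fun k => W (s k) w)) ->
  (\int[P]_(w in [set w | A (W^~ w)]) F (W^~ w) =
   \int[P]_(w in [set w | A (fun k => W (s k) w)]) F (fun k => W (s k) w))%E.
Proof.
move=> st ts Ws mF mA i1 i2.
have mW1 := measurable_sample mW.
have mW2 : measurable_fun setT (fun w => (fun k => W (s k) w) : T2).
  exact: measurable_sample.
have i1A : P.-integrable [set w | A (W^~ w)] (fun w => F (W^~ w)).
  by apply: integrableS i1 => //; rewrite -[X in measurable X]setTI; exact: mW1.
have i2A : P.-integrable [set w | A (fun k => W (s k) w)]
    (fun w => F (fun k => W (s k) w)).
  by apply: integrableS i2 => //; rewrite -[X in measurable X]setTI; exact: mW2.
rewrite -[LHS](integral_pushforward mW1 mF i1A mA).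
rewrite -[RHS](integral_pushforward mW2 mF i2A mA).
by apply: eq_measure_integral => B mB _; exact: (relabel_law st ts Ws).
Qed.

End Relabel.

(** * Kernels under relabelling of rows and columns *)

Section Kernel.
Context (R : realType) (S : Type) (p q : nat) (h : 'M[R]_(p, q) -> R).
Hypothesis kh : is_kernel h.
Implicit Types (Y : nat -> nat -> S -> R) (i j : {fset nat}).

(** The sets of matrices whose preimage under [submx_at] lies in [G] form a sigma-algebra, and it
    contains the events on a single entry. *)
Lemma measurable_wrt_kernel_at (G : set_system S) Y i j : sigma_algebra setT G ->
  (forall a b, measurable_wrt G (Y a b)) -> measurable_wrt G (kernel_at h Y i j).
Proof.
move=> sG GY B mB; have [_ _ mh _] := kh.
have := @sigma_fam_sub _ _ _ setT
  (fun (k : 'I_p * 'I_q) (M : 'M[R]_(p, q)) => M k.1 k.2)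
  _ (sigma_algebra_image (submx_at Y p q i j) sG).
move=> /(_ _ (h @^-1` B) (mh _ mB)); rewrite /image_set_system/= setTI; apply.
move=> k D _ mD; rewrite setTI.
rewrite [X in G X](_ : _ = Y (nth 0%N (sort leq i) k.1)
    (nth 0%N (sort leq j) k.2) @^-1` D).
  exact: GY.
by apply/seteqP; split=> w /=; rewrite mxE.
Qed.

(** [submx_at] lists indices in increasing order, which an injection may destroy; [r] restores it,
    and the symmetry of a kernel later absorbs [r]. *)
Lemma sort_imfset_perm (s : nat -> nat) n i : injective s -> #|` i| = n ->
  exists r : 'S_n, forall a : 'I_n,
    s (nth 0%N (sort leq i) a) = nth 0%N (sort leq (s @` i)%fset) (r a).
Proof.
move=> sI cn.
have sz : size (map s (sort leq i)) == n by rewrite size_map size_sort cn.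
have sz' : size (sort leq (s @` i)%fset) == n by rewrite size_sort card_imfset//= cn.
have : perm_eq (Tuple sz) (Tuple sz').
  apply: uniq_perm => /=; first by rewrite map_inj_uniq// sort_uniq fset_uniq.
    by rewrite sort_uniq fset_uniq.
  move=> k; rewrite mem_sort; apply/mapP/imfsetP => -[l /= lk ->]; exists l => //.
    by rewrite mem_sort in lk.
  by rewrite mem_sort.
move/tuple_permP => [r rE]; exists r => a.
have a1 : (a < size (sort leq i))%N by rewrite size_sort cn.
rewrite -(nth_map 0%N 0%N)// [map _ _]rE (nth_map a) ?size_enum_ord// nth_ord_enum.
by rewrite (tnth_nth 0%N).
Qed.

Lemma kernel_at_imfset Y (s t : nat -> nat) i j w :
  injective s -> injective t -> #|` i| = p -> #|` j| = q ->
  kernel_at h (fun a b => Y (s a) (t b)) i j w =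
  kernel_at h Y (s @` i)%fset (t @` j)%fset w.
Proof.
move=> sI tI cp cq; have [_ _ _ hperm] := kh.
have [r rE] := sort_imfset_perm sI cp; have [u uE] := sort_imfset_perm tI cq.
rewrite /kernel_at -[RHS](hperm r u); congr h.
by apply/matrixP => a b; rewrite !mxE rE uE.
Qed.

End Kernel.

(** * Bijections between finite index sets *)

Lemma card_initial m : #|` initial m| = m.
Proof.
by rewrite /initial card_imfset//= undup_id ?iota_uniq// size_iota.
Qed.

(* By induction on |A \ B|, composing with a transposition of an element of A \ B
   and one of B \ A. *)
Lemma fset_bijection (A B : {fset nat}) : #|` A| = #|` B| ->
  exists s t : nat -> nat, [/\ cancel s t, cancel t s, (s @` A)%fset = B
    & forall k, k \in A -> k \in B -> s k = k].
Proof.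
have [n] := ubnP #|` (A `\` B)%fset|; elim: n => // n IH in A *; rewrite ltnS => An AB.
have [A0|[a]] := fset_0Vmem (A `\` B)%fset.
  have BA : A = B.
    by apply/eqP; rewrite eqEfcard AB leqnn andbT -fsetD_eq0 A0.
  exists id, id; split=> //; rewrite BA.
  by apply/fsetP => k; apply/imfsetP/idP => [[l /= lB ->//]|kB]; exists k.
have [B0|[b]] := fset_0Vmem (B `\` A)%fset.
  suff BA : B = A by rewrite BA fsetDv inE.
  by apply/eqP; rewrite eqEfcard AB leqnn andbT -fsetD_eq0 B0.
rewrite !inE => /andP[bA bB] /andP[aB aA].
pose sw k := if k == a then b else if k == b then a else k.
have swK : involutive sw.
  move=> k; rewrite /sw; case: (eqVneq k a) => [->|ka].
    by rewrite eqxx; case: eqP => // ->.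
  by case: (eqVneq k b) => [->|kb]; rewrite ?eqxx// (negbTE ka) (negbTE kb).
have swA : (sw @` A)%fset = (b |` (A `\ a))%fset.
  apply/fsetP => k; rewrite !inE; apply/imfsetP/idP => [[l /= lA ->]|].
    rewrite /sw; case: (eqVneq l a) => [|la]; first by rewrite eqxx.
    by case: (eqVneq l b) lA bA => [->->//|_ lA _]; rewrite la lA orbT.
  move=> /orP[/eqP ->|/andP[ka kA]]; first by exists a; rewrite // /sw eqxx.
  by exists k => //; rewrite /sw (negbTE ka); case: eqP kA bA => // -> ->.
have cA : #|` (sw @` A)%fset| = #|` B|.
  by rewrite card_imfset//=; exact: can_inj swK.
have [||s [t [st ts sA sfix]]] := IH (sw @` A)%fset => //.
  apply: leq_trans An; rewrite swA.
  have -> : ((b |` (A `\ a)) `\` B = (A `\` B) `\ a)%fset.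
    apply/fsetP => k; rewrite !inE; case: (eqVneq k b) => [->|_].
      by rewrite bB/= andbF.
    by rewrite /= andbCA.
  by apply/fproper_ltn_card/fproperD1; rewrite !inE aB.
exists (s \o sw), (sw \o t); split.
- exact: can_comp.
- exact: can_comp.
- by rewrite imfset_comp sA.
(* An element of both [A] and [B] is neither [a] nor [b], so the swap fixes it and it remains in the
   swapped set. *)
- move=> k kA kB /=; have -> : sw k = k.
    rewrite /sw; case: eqP kB aB => [-> ->//|_ _ _].
    by case: eqP kA bA => [-> ->//|].
  apply: sfix => //; rewrite swA !inE kA andbT; apply/orP; right.
  by apply: contraNneq aB => <-.
Qed.

(** * Events as sets of sample families *)

Section SigmaFamPreimage.
Context (R : realType) (S : Type) (I : choiceType) (W : I -> S -> R) (D : set I).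

Let coords (k : I) (M : I -> R) : R := M k.

(** Lifts an event to the space of families, where a relabelling can act on it. *)
Lemma sigma_fam_preimage A : sigma_fam D W A ->
  exists2 A', sigma_fam D coords A' & A = [set w | A' (W^~ w)].
Proof.
have sD := sigma_algebra_preimage setT (fun w => W^~ w)
  (sigma_fam_sigma_algebra D coords).
move=> WA; have [|A' A'D <-] := sigma_fam_sub sD _ WA;
  last by exists A'; rewrite ?setTI.
move=> k B Dk mB; exists (coords k @^-1` B); last by rewrite setTI.
exact: sigma_fam_gen.
Qed.

(** The sets that do not separate [M] from [M'] form a sigma-algebra containing the generators. *)
Lemma sigma_fam_coords A (M M' : I -> R) : sigma_fam D coords A ->
  (forall k, D k -> M k = M' k) -> A M = A M'.
Proof.
move=> DA MM'; move: A DA.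
apply: (@sigma_fam_sub _ _ _ _ _ [set A | A M = A M']).
  split=> //=.
  - by move=> A AM; rewrite /setD/= AM.
  - by move=> F FM; apply/propext; split=> -[n _ Fn]; exists n => //; rewrite ?FM// -FM.
by move=> k B Dk mB; rewrite /= /preimage/= /coords MM'.
Qed.

End SigmaFamPreimage.

(** * Relabelling the AHK variables *)

Section AHK.
Context d (T : measurableType d) (R : realType) (P : probability T R).
Context (Y : nat -> nat -> {RV P >-> R}) (phi : R * R * R -> R).
Context (xi eta : nat -> {RV P >-> R}) (zeta : nat -> nat -> {RV P >-> R}).
Hypothesis ahk : ahk_representation Y phi xi eta zeta.

Let K := (nat + nat + nat * nat)%type.
Let W : K -> T -> R := ahk_variables xi eta zeta.
Let coords (k : K) (M : K -> R) : R := M k.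
Let T2 := g_sigma_algebraType (cylinders setT coords).

Definition ahk_relabel (s t : nat -> nat) (k : K) : K :=
  match k with
  | inl (inl a) => inl (inl (s a))
  | inl (inr b) => inl (inr (t b))
  | inr (a, b) => inr (s a, t b)
  end.

Lemma ahk_relabelK s s' t t' : cancel s s' -> cancel t t' ->
  cancel (ahk_relabel s t) (ahk_relabel s' t').
Proof. by move=> ss tt [[a|b]|[a b]] /=; rewrite ?ss ?tt. Qed.

Lemma measurable_ahk k : measurable_fun setT (W k).
Proof. by case: k => [[a|b]|[a b]] /=. Qed.

Lemma ahk_independent : mutually_independent P W.
Proof. by have [_ _ ] := ahk. Qed.

Lemma ahk_uniform k (B : set R) : measurable B ->
  P (W k @^-1` B) = uniform_prob (@ltr01 R) B.
Proof.
have [_ [xiU etaU zetaU] _ _] := ahk.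
by case: k => [[a|b]|[a b]] mB; [exact: xiU|exact: etaU|exact: zetaU].
Qed.

Lemma ahk_relabel_law s t k (B : set R) : measurable B ->
  P (W (ahk_relabel s t k) @^-1` B) = P (W k @^-1` B).
Proof. by move=> mB; rewrite !ahk_uniform. Qed.

(** A matrix entry as a function of the whole family of AHK variables; [Y] agrees with it almost
    surely, while relabelling acts on it exactly. *)
Definition ahk_entry (a b : nat) (M : K -> R) : R :=
  phi (M (inl (inl a)), M (inl (inr b)), M (inr (a, b))).

Lemma measurable_ahk_entry a b :
  measurable_wrt (sigma_fam setT coords) (ahk_entry a b).
Proof.
have [mphi _ _ _] := ahk.
have sC := @sigma_fam_sigma_algebra R (K -> R) K setT coords.
have mc k : measurable_fun setT
    (coords k : g_sigma_algebraType (sigma_fam setT coords) -> R).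
  by apply/(measurable_wrtP sC) => B mB; exact: sigma_fam_gen.
apply/(measurable_wrtP sC); apply: (measurableT_comp mphi).
apply: measurable_fun_pair; last exact: mc.
by apply: measurable_fun_pair; exact: mc.
Qed.

Context (p q : nat) (h : 'M[R]_(p, q) -> R).
Hypothesis kh : is_kernel h.

Lemma measurable_kernel_ahk i j :
  measurable_fun setT (kernel_at h ahk_entry i j : T2 -> R).
Proof.
move=> _ B mB; rewrite setTI.
suff : sigma_fam setT coords (kernel_at h ahk_entry i j @^-1` B).
  by rewrite sigma_fam_cylinders.
apply: measurable_wrt_kernel_at mB => //; first exact: sigma_fam_sigma_algebra.
exact: measurable_ahk_entry.
Qed.

Lemma measurable_kernel_at i j : measurable_fun setT (kernel_at h Y i j).
Proof.
move=> _ B mB; rewrite setTI.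
apply: measurable_wrt_kernel_at mB => //; first exact: sigma_algebra_measurable.
by move=> a b D mD; rewrite -[X in measurable X]setTI; exact: measurable_funP.
Qed.

Lemma kernel_at_ahk i j :
  {ae P, forall w, kernel_at h Y i j w = kernel_at h ahk_entry i j (W^~ w)}.
Proof.
have [_ _ _ YE] := ahk.
have : {ae P, forall w, forall a b, Y a b w = ahk_entry a b (W^~ w)}.
  by apply/ae_foralln => a; apply/ae_foralln => b; exact: YE.
apply: filterS => w Yw; congr h; apply/matrixP => a b; rewrite !mxE.
exact: Yw.
Qed.

Lemma kernel_ahk_relabel s t i j M : injective s -> injective t ->
  #|` i| = p -> #|` j| = q ->
  kernel_at h ahk_entry i j (fun k => M (ahk_relabel s t k)) =
  kernel_at h ahk_entry (s @` i)%fset (t @` j)%fset M.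
Proof. by move=> sI tI ip jq; rewrite -kernel_at_imfset. Qed.

Hypothesis h2 : ('E_P[kernel_at h Y (initial p) (initial q) ^+ 2] < +oo)%E.

(** Almost sure equality is enough under an integral. The function [f] allows squares, absolute
    values and the identity. *)
Lemma integral_kernel_at_ahk i j A (f : R -> R) : measurable A ->
  measurable_fun setT f ->
  (\int[P]_(w in A) (f (kernel_at h Y i j w))%:E =
   \int[P]_(w in A) (f (kernel_at h ahk_entry i j (W^~ w)))%:E)%E.
Proof.
move=> mA mf; apply: ae_eq_integral => //.
- apply/measurable_funTS/measurable_EFinP/measurableT_comp => //.
  exact: measurable_kernel_at.
- apply/measurable_funTS/measurable_EFinP/measurableT_comp => //.
  have mW := measurable_sample measurable_ahk.
  exact: (measurableT_comp (measurable_kernel_ahk i j) mW).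
- by apply: filterS (kernel_at_ahk i j) => w ->.
Qed.

(** A relabelling that carries the initial rows and columns onto [i] and [j] preserves the law of
    the AHK variables, so the second moment is the one bounded in [h2]. *)
Lemma kernel_at_Lfun2 i j : #|` i| = p -> #|` j| = q ->
  kernel_at h Y i j \in Lfun P 2%:E.
Proof.
move=> ip jq; apply/Lfun2P; split; first exact: measurable_kernel_at.
move: h2; rewrite unlock; apply: le_lt_trans.
have msq : measurable_fun setT (fun x : R => x ^+ 2) by exact: measurable_funX.
have [s [s' [ss s's si _]]] := fset_bijection (etrans (card_initial p) (esym ip)).
have [t [t' [tt t't tj _]]] := fset_bijection (etrans (card_initial q) (esym jq)).
rewrite (integral_kernel_at_ahk i j measurableT msq).
rewrite (_ : \int[P]_w _ =
  \int[P]_w (kernel_at h Y (initial p) (initial q) w ^+ 2)%:E)%E//.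
rewrite (integral_kernel_at_ahk (initial p) (initial q) measurableT msq).
have := @relabel_integral_ge0 _ _ _ P K W measurable_ahk ahk_independent _ _
  (fun M => (kernel_at h ahk_entry (initial p) (initial q) M ^+ 2)%:E)
  (ahk_relabelK ss tt) (ahk_relabelK s's t't) (@ahk_relabel_law s t).
move=> -> //.
- rewrite le_eqVlt; apply/orP; left; apply/eqP; apply: eq_integral => w _.
  rewrite -si -tj -(@kernel_ahk_relabel s t _ _ (W^~ w)) ?card_initial//; exact: can_inj.
- apply/measurable_EFinP/(measurableT_comp msq); exact: measurable_kernel_ahk.
- by move=> M; rewrite lee_fin sqr_ge0.
Qed.

(* The choice of the superset (i1, j1) of (i, j) is immaterial in psi. *)
Lemma integral_kernel_at_eq i j i1 j1 i2 j2 A : ahk_sigma xi eta zeta i j A ->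
  (i `<=` i1)%fset -> (j `<=` j1)%fset -> (i `<=` i2)%fset -> (j `<=` j2)%fset ->
  #|` i1| = p -> #|` j1| = q -> #|` i2| = p -> #|` j2| = q ->
  (\int[P]_(w in A) (kernel_at h Y i1 j1 w)%:E =
   \int[P]_(w in A) (kernel_at h Y i2 j2 w)%:E)%E.
Proof.
move=> sA /fsubsetP ii1 /fsubsetP jj1 /fsubsetP ii2 /fsubsetP jj2 ip1 jq1 ip2 jq2.
have mA : measurable A by apply: sigma_fam_measurable sA => //; exact: measurable_ahk.
have mid : measurable_fun setT (@id R) by [].
rewrite (integral_kernel_at_ahk _ _ mA mid) (integral_kernel_at_ahk _ _ mA mid).
have [s [s' [ss s's si sfix]]] := fset_bijection (etrans ip2 (esym ip1)).
have [t [t' [tt t't tj tfix]]] := fset_bijection (etrans jq2 (esym jq1)).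
have [A' DA' AE] := sigma_fam_preimage sA.
have iF i0 j0 : #|` i0| = p -> #|` j0| = q ->
  P.-integrable setT (fun w => (kernel_at h ahk_entry i0 j0 (W^~ w))%:E).
  move=> ip jq; have := Lfun2_integrable (kernel_at_Lfun2 ip jq).
  move=> /integrableP[_ foo]; apply/integrableP; split.
    apply/measurable_EFinP; have mW := measurable_sample measurable_ahk.
    exact: (measurableT_comp (measurable_kernel_ahk i0 j0) mW).
  move: foo; rewrite /= (integral_kernel_at_ahk i0 j0 measurableT (f := fun x => `|x|))//.
have E w : kernel_at h ahk_entry i2 j2 (fun k => W (ahk_relabel s t k) w) =
    kernel_at h ahk_entry i1 j1 (W^~ w).
  by rewrite -si -tj -(@kernel_ahk_relabel s t _ _ (W^~ w))//; exact: can_inj.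
have := @relabel_integral _ _ _ P K W measurable_ahk ahk_independent _ _
  (fun M => (kernel_at h ahk_entry i2 j2 M)%:E) A'
  (ahk_relabelK ss tt) (ahk_relabelK s's t't) (@ahk_relabel_law s t).
(* The relabelling fixes the indices common to both supersets, in particular those of [i] and [j],
   on which alone [A'] depends. *)
have -> : [set w | A' (fun k => W (ahk_relabel s t k) w)] = A.
  rewrite AE; apply/funext => w; apply: sigma_fam_coords DA' _ => k Dk.
  rewrite /W; case: k Dk => [[a|b]|[a b]] /=.
  - by move=> ai; rewrite sfix; [|exact: ii2|exact: ii1].
  - by move=> bj; rewrite tfix; [|exact: jj2|exact: jj1].
  - move=> /andP[ai bj]; rewrite sfix; [|exact: ii2|exact: ii1].
    by rewrite tfix; [|exact: jj2|exact: jj1].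
rewrite -AE => ->//.
- by apply: eq_integral => w _; rewrite E.
- by apply/measurable_EFinP; exact: measurable_kernel_ahk.
- suff : sigma_fam setT coords A' by rewrite sigma_fam_cylinders.
  by apply: sigma_famS DA'.
- exact: iF.
- by under eq_fun do rewrite E; exact: iF.
Qed.

End AHK.

(** * The projections *)

Section SubsetSums.
Context (V : zmodType).

Lemma big_fsetM (I J : choiceType) (A : {fset I}) (B : {fset J}) (f : I * J -> V) :
  \sum_(x <- (A `*` B)%fset) f x = \sum_(a <- A) \sum_(b <- B) f (a, b).
Proof.
rewrite -big_allpairs.
apply: perm_big; apply: uniq_perm => //.
  by apply: allpairs_uniq => // -[? ?] [? ?].
move=> -[a b]; rewrite in_fsetM /=; apply/andP/allpairsP.
  by move=> [aA bB]; exists (a, b).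
by move=> [[a' b'] [/= aA bB [-> ->]]].
Qed.

Lemma sum_ksubsets (i : {fset nat}) (f : nat -> {fset nat} -> V) :
  \sum_(r < #|` i|.+1) \sum_(a <- ksubsets r i) f r a =
  \sum_(a <- fpowerset i) f #|` a| a.
Proof.
under eq_bigr do rewrite -big_fset_condE.
rewrite (exchange_big_dep predT)//= big_seq [RHS]big_seq; apply: eq_bigr => a.
rewrite fpowersetE => ai; have ci : (#|` a| < #|` i|.+1)%N.
  by rewrite ltnS fsubset_leq_card.
by rewrite (big_pred1 (Ordinal ci))// => r /=; rewrite eq_sym.
Qed.

End SubsetSums.

Definition fsubpairs (i j : {fset nat}) : {fset {fset nat} * {fset nat}} :=
  (fpowerset i `*` fpowerset j)%fset.

Definition proper_fsubpairs (i j : {fset nat}) : {fset {fset nat} * {fset nat}} :=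
  (fsubpairs i j `\ (i, j))%fset.

Lemma in_fsubpairs i j x :
  (x \in fsubpairs i j) = (x.1 `<=` i)%fset && (x.2 `<=` j)%fset.
Proof. by rewrite in_fsetM !fpowersetE. Qed.

(** Provides the decrease for the inductions on projections: equal sums would force both cardinals,
    hence both sets, to coincide. *)
Lemma fsubpairs_card i j x : x \in proper_fsubpairs i j ->
  (#|` x.1| + #|` x.2| < #|` i| + #|` j|)%N.
Proof.
rewrite in_fsetD1 in_fsubpairs => /andP[xij /andP[xi xj]].
rewrite ltn_neqAle leq_add ?fsubset_leq_card// andbT.
apply: contra xij => /eqP xE; case: x xE xi xj => a b /= xE xi xj.
have [ca cb] := (fsubset_leq_card xi, fsubset_leq_card xj).
rewrite xpair_eqE !eqEfcard xi xj/=; apply/andP; split.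
  by rewrite -(leq_add2r #|` b|) xE leq_add2l.
by rewrite -(leq_add2l #|` a|) xE leq_add2r.
Qed.

Lemma pproj_fsubpairs (R : realType) (T : Type)
    (psi : nat -> nat -> {fset nat} -> {fset nat} -> T -> R) (i j : {fset nat}) w :
  pproj psi #|` i| #|` j| i j w = psi #|` i| #|` j| i j w -
    \sum_(x <- proper_fsubpairs i j)
      pproj psi #|` x.1| #|` x.2| x.1 x.2 w.
Proof.
rewrite pprojE; congr (_ - _).
(* Extending by zero at the excluded pair of sizes makes the range of sizes a rectangle, so that the
   sums can be exchanged. *)
pose f r c (a b : {fset nat}) : R :=
  if (r, c) != (#|` i|, #|` j|) then pproj psi r c a b w else 0.
transitivity (\sum_(r < #|` i|.+1) \sum_(a <- ksubsets r i)
    \sum_(c < #|` j|.+1) \sum_(b <- ksubsets c j) f r c a b).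
  apply: eq_bigr => r _; rewrite [RHS]exchange_big/= big_mkcond/=.
  apply: eq_bigr => c _; rewrite /f; case: ifP => // _.
  by rewrite big1// => a _; rewrite big1.
rewrite (sum_ksubsets i (fun r a =>
  \sum_(c < #|` j|.+1) \sum_(b <- ksubsets c j) f r c a b)).
under eq_bigr do rewrite (sum_ksubsets j (fun c b => f _ c _ b)).
transitivity (\sum_(x <- fsubpairs i j | x != (i, j))
    pproj psi #|` x.1| #|` x.2| x.1 x.2 w).
  rewrite [RHS]big_mkcond /fsubpairs big_fsetM/=.
  rewrite big_seq [RHS]big_seq; apply: eq_bigr => a; rewrite fpowersetE => ai.
  rewrite big_seq [RHS]big_seq; apply: eq_bigr => b; rewrite fpowersetE => bj.
  (* For subsets of [i] and [j], having full sizes amounts to being [i] and [j] themselves. *)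
  rewrite /f; congr (if ~~ _ then _ else _).
  rewrite !xpair_eqE !eqEfcard ai bj/= !eqn_leq.
  by rewrite (fsubset_leq_card ai) (fsubset_leq_card bj).
rewrite big_fset_condE; apply: eq_fbigl => x; rewrite !inE/=.
by rewrite andbC.
Qed.

Lemma psi_fsubpairs (R : realType) (T : Type)
    (psi : nat -> nat -> {fset nat} -> {fset nat} -> T -> R) (i j : {fset nat}) w :
  psi #|` i| #|` j| i j w =
  \sum_(x <- fsubpairs i j) pproj psi #|` x.1| #|` x.2| x.1 x.2 w.
Proof.
have ijin : (i, j) \in fsubpairs i j by rewrite in_fsubpairs /= !fsubset_refl.
by rewrite (big_fsetD1 _ ijin)/= pproj_fsubpairs subrK.
Qed.

(** * Measurability and centering of the projections *)

Section Projections.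
Context d (T : measurableType d) (R : realType) (P : probability T R).
Context (Y : nat -> nat -> {RV P >-> R}) (phi : R * R * R -> R).
Context (xi eta : nat -> {RV P >-> R}) (zeta : nat -> nat -> {RV P >-> R}).
Hypothesis ahk : ahk_representation Y phi xi eta zeta.

Let K := (nat + nat + nat * nat)%type.

Definition ahk_index (i j : {fset nat}) : set K :=
  [set k | match k with
           | inl (inl a) => a \in i
           | inl (inr b) => b \in j
           | inr (a, b) => (a \in i) && (b \in j)
           end].

(** An index of [zeta] requires both its row and its column, so intersecting rows and columns
    separately gives the exact intersection. *)
Lemma ahk_indexI i j i' j' :
  ahk_index i j `&` ahk_index i' j' = ahk_index (i `&` i')%fset (j `&` j')%fset.
Proof.
apply/seteqP; split=> -[[a|b]|[a b]] /=; rewrite !inE.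
- by move=> [-> ->].
- by move=> [-> ->].
- by move=> [/andP[-> ->] /andP[-> ->]].
- by move=> /andP[-> ->].
- by move=> /andP[-> ->].
- by move=> /andP[/andP[-> ->] /andP[-> ->]].
Qed.

Lemma ahk_indexS i j i' j' : (i `<=` i')%fset -> (j `<=` j')%fset ->
  ahk_index i j `<=` ahk_index i' j'.
Proof.
move=> /fsubsetP ii /fsubsetP jj [[a|b]|[a b]] /=; [exact: ii|exact: jj|].
by move=> /andP[/ii -> /jj ->].
Qed.

Context (p q : nat) (h : 'M[R]_(p, q) -> R).
Context (psi : nat -> nat -> {fset nat} -> {fset nat} -> T -> R).
Hypothesis kh : is_kernel h.
Hypothesis h2 : ('E_P[kernel_at h Y (initial p) (initial q) ^+ 2] < +oo)%E.
Hypothesis psiE : is_psi P Y xi eta zeta h psi.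

Let G i j := ahk_sigma xi eta zeta i j.
Let g i j := pproj psi #|` i| #|` j| i j.

Let sG i j : sigma_algebra setT (G i j).
Proof. exact: sigma_fam_sigma_algebra. Qed.

Let Gm i j : G i j `<=` measurable.
Proof. by apply: sigma_fam_measurable => k; exact: measurable_ahk. Qed.

(** Both properties hold for [psi], a conditional expectation of a square-integrable variable, and
    pass through the recursion by differences and finite sums. *)
Lemma pproj_measurable_Lfun2 i j : (#|` i| <= p)%N -> (#|` j| <= q)%N ->
  measurable_wrt (G i j) (g i j) /\ g i j \in Lfun P 2%:E.
Proof.
have [n] := ubnP (#|` i| + #|` j|); elim: n => // n IH in i j *.
rewrite ltnS => ijn ip jq.
have [I [J [cI cJ iI jJ cond]]] := psiE ip jq erefl erefl.
have sub x : x \in proper_fsubpairs i j ->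
    measurable_wrt (G i j) (g x.1 x.2) /\ g x.1 x.2 \in Lfun P 2%:E.
  move=> xij; have cx := fsubpairs_card xij; move: xij.
  rewrite in_fsetD1 in_fsubpairs => /and3P[_ xi1 xj1].
  have [||mx Lx] := IH x.1 x.2 (leq_trans cx ijn).
  - exact: leq_trans (fsubset_leq_card xi1) ip.
  - exact: leq_trans (fsubset_leq_card xj1) jq.
  split=> // B mB; apply: sigma_famS (mx B mB).
  exact: ahk_indexS.
have gE : g i j = psi #|` i| #|` j| i j -
    \sum_(x <- proper_fsubpairs i j) g x.1 x.2.
  by apply/funext => w; rewrite /g pproj_fsubpairs/= fct_sumE.
rewrite gE; split.
- apply/(measurable_wrtP (sG i j)); apply: measurable_funB.
    by apply/(measurable_wrtP (sG i j)); case: cond.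
  (* Summands are set to zero outside the range because measurability is asked of every index, while
     [sub] covers proper subpairs. *)
  have -> : \sum_(x <- proper_fsubpairs i j) g x.1 x.2 =
      fun w => \sum_(x <- proper_fsubpairs i j)
        if x \in proper_fsubpairs i j then g x.1 x.2 w else 0.
    by apply/funext => w; rewrite fct_sumE big_seq [RHS]big_seq; apply: eq_bigr => x ->.
  apply: (@measurable_sum _ (g_sigma_algebraType (G i j))) => x.
  have [/sub[mx _]|_ //] := boolP (x \in proper_fsubpairs i j).
  exact/(measurable_wrtP (sG i j)).
- apply: rpredB; first by rewrite lee1n.
    move=> le12.
    apply: (condexp_Lfun2 (sG i j) (@Gm i j) _ cond).
    exact: (kernel_at_Lfun2 ahk kh h2).
  by move=> le12; rewrite big_seq; apply: rpred_sum => x /sub[].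
Qed.

Lemma null_on_pproj i j i' j' : (#|` i| <= p)%N -> (#|` j| <= q)%N ->
  ~~ ((i `<=` i')%fset && (j `<=` j')%fset) -> null_on P (G i' j') (g i j).
Proof.
have [n] := ubnP (#|` i| + #|` j|); elim: n => // n IH in i j i' j' *.
rewrite ltnS => ijn ip jq ij'.
have [mg Lg] := pproj_measurable_Lfun2 ip jq.
apply: (null_on_setI (@measurable_ahk _ _ _ _ _ _ _) (ahk_independent ahk)
  mg (Lfun2_integrable Lg)).
rewrite ahk_indexI -/(ahk_sigma _ _ _ _ _).
set i0 := (i `&` i')%fset; set j0 := (j `&` j')%fset => A A0.
have mA : measurable A by exact: Gm A0.
have i0i : (i0 `<=` i)%fset by exact: fsubsetIl.
have j0j : (j0 `<=` j)%fset by exact: fsubsetIl.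
have A1 : G i j A by apply: sigma_famS A0; exact: ahk_indexS.
(* Being included in [i0] or [j0] is the same for [i] or [j] as being included in [i'] or [j'], so
   the assumption survives the reduction. *)
have ij0 : ~~ ((i `<=` i0)%fset && (j `<=` j0)%fset).
  by rewrite !fsubsetI !fsubset_refl.
have i0p := leq_trans (fsubset_leq_card i0i) ip.
have j0q := leq_trans (fsubset_leq_card j0j) jq.
have sum_g a b : (#|` a| <= p)%N -> (#|` b| <= q)%N ->
    (\int[P]_(w in A) (psi #|` a| #|` b| a b w)%:E =
     \sum_(x <- fsubpairs a b) \int[P]_(w in A) (g x.1 x.2 w)%:E)%E.
  move=> ap bq; pose V x := if x \in fsubpairs a b then g x.1 x.2 else cst 0.
  have VE x : x \in fsubpairs a b -> V x = g x.1 x.2 by rewrite /V => ->.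
  have iV x : P.-integrable A (EFin \o V x).
    rewrite /V; case: ifPn => [|_]; last exact: integrable0.
    rewrite in_fsubpairs => /andP[xa xb].
    have [||_ Lx] := @pproj_measurable_Lfun2 x.1 x.2.
    - exact: leq_trans (fsubset_leq_card xa) ap.
    - exact: leq_trans (fsubset_leq_card xb) bq.
    by apply: integrableS (Lfun2_integrable Lx).
  transitivity (\int[P]_(w in A) \sum_(x <- fsubpairs a b) (V x w)%:E)%E.
    apply: eq_integral => w _; rewrite psi_fsubpairs -sumEFin.
    by apply: eq_fbigr => x xab _; rewrite VE.
  by rewrite integral_sum//; apply: eq_fbigr => x xab _; rewrite VE.
(* [A] belongs to both sigma-algebras, so each side is the integral over [A] of the kernel on some
   superset, and the superset is immaterial. *)
have psi_eq : (\int[P]_(w in A) (psi #|` i| #|` j| i j w)%:E =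
    \int[P]_(w in A) (psi #|` i0| #|` j0| i0 j0 w)%:E)%E.
  have [I [J [cI cJ iI jJ [_ _ ->//]]]] := psiE ip jq erefl erefl.
  have [I0 [J0 [cI0 cJ0 iI0 jJ0 [_ _ ->//]]]] := psiE i0p j0q erefl erefl.
  apply: (integral_kernel_at_eq ahk kh h2 A0) => //.
    exact: fsubset_trans iI.
  exact: fsubset_trans jJ.
have ijin : (i, j) \in fsubpairs i j by rewrite in_fsubpairs /= !fsubset_refl.
have sub0 : (fsubpairs i0 j0 `<=` proper_fsubpairs i j)%fset.
  apply/fsubsetP => x; rewrite in_fsetD1 !in_fsubpairs => /andP[xI xJ].
  rewrite (fsubset_trans xI)// (fsubset_trans xJ)// !andbT.
  by apply: contraNneq ij0 => xE; move: xI xJ; rewrite xE /= => -> ->.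
have := psi_eq; rewrite !sum_g// (big_fsetD1 _ ijin)/= -/(proper_fsubpairs i j).
(* By induction, the proper subpairs not included in [(i0, j0)] contribute zero; the others sum to
   the expansion of [psi] at [(i0, j0)]. *)
rewrite -(big_fset_incl _ sub0); last first.
  move=> x xij xij0; have cx := fsubpairs_card xij; move: xij.
  rewrite in_fsetD1 in_fsubpairs => /and3P[_ xI xJ].
  apply: (IH _ _ i0 j0 (leq_trans cx ijn) _ _ _ A A0).
  - exact: leq_trans (fsubset_leq_card xI) ip.
  - exact: leq_trans (fsubset_leq_card xJ) jq.
  - by rewrite -in_fsubpairs.
rewrite -sum_g//.
set a := (X in (_ + X)%E = X -> _).
(* Finiteness is what permits cancelling [a] in the extended reals. *)
have afin : a \is a fin_num.
  have [I0 [J0 [_ _ _ _ [_ ipsi _]]]] := psiE i0p j0q erefl erefl.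
  by apply: integrable_fin_num => //; apply: integrableS ipsi.
by move/(congr1 (fun z => z - a)%E); rewrite addeK// subee.
Qed.

End Projections.

(** * Vanishing covariances *)

Lemma covariance_pproj d (T : measurableType d) (R : realType) (P : probability T R)
    (Y : nat -> nat -> {RV P >-> R}) (phi : R * R * R -> R)
    (xi eta : nat -> {RV P >-> R}) (zeta : nat -> nat -> {RV P >-> R})
    (p1 q1 p2 q2 : nat) (h1 : 'M[R]_(p1, q1) -> R) (h2 : 'M[R]_(p2, q2) -> R)
    (psi1 psi2 : nat -> nat -> {fset nat} -> {fset nat} -> T -> R)
    (i1 j1 i2 j2 : {fset nat}) :
  ahk_representation Y phi xi eta zeta -> is_kernel h1 -> is_kernel h2 ->
  ('E_P[kernel_at h1 Y (initial p1) (initial q1) ^+ 2] < +oo)%E ->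
  ('E_P[kernel_at h2 Y (initial p2) (initial q2) ^+ 2] < +oo)%E ->
  is_psi P Y xi eta zeta h1 psi1 -> is_psi P Y xi eta zeta h2 psi2 ->
  (#|` i1| <= p1)%N -> (#|` j1| <= q1)%N -> (#|` i2| <= p2)%N -> (#|` j2| <= q2)%N ->
  ~~ ((i1 `<=` i2)%fset && (j1 `<=` j2)%fset) ->
  covariance P (pproj psi1 #|` i1| #|` j1| i1 j1)
               (pproj psi2 #|` i2| #|` j2| i2 j2) = 0%E.
Proof.
move=> ahk k1 k2 sq1 sq2 psi1E psi2E ip1 jq1 ip2 jq2 sub.
have [_ L1] := pproj_measurable_Lfun2 ahk k1 sq1 psi1E ip1 jq1.
have [m2 L2] := pproj_measurable_Lfun2 ahk k2 sq2 psi2E ip2 jq2.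
have N1 := null_on_pproj ahk k1 sq1 psi1E ip1 jq1 sub.
have L12 := Lfun2_mul_Lfun1 L1 L2.
have i1' := Lfun2_integrable L1.
rewrite covarianceE//;
  [|exact/Lfun1_integrable|exact/Lfun1_integrable/Lfun2_integrable].
(* The whole space belongs to the sigma-algebra of [(i2, j2)], so the first projection is centered
   and the covariance is the mean of the product. *)
have E1 : ('E_P[pproj psi1 #|` i1| #|` j1| i1 j1] = 0)%E.
  rewrite unlock; apply: N1; apply: cylinders_sigma_fam; exact: cylindersT.
rewrite E1 mul0e sube0 unlock.
apply: (null_on_mul (sigma_fam_sigma_algebra _ _) _ i1' N1 m2).
  by apply: sigma_fam_measurable => k; exact: measurable_ahk.
exact/Lfun1_integrable.
Qed.

Theorem proposition3p1 (d : measure_display) (T : measurableType d)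
  (R : realType) (P : probability T R) (Y : nat -> nat -> {RV P >-> R})
  (phi : R * R * R -> R) (xi eta : nat -> {RV P >-> R})
  (zeta : nat -> nat -> {RV P >-> R})
  (hrce : row_column_exchangeable P Y) (hdis : dissociated P Y)
  (hahk : ahk_representation Y phi xi eta zeta)
  (m n : nat) (hm : (1 <= m)%N) (hn : (1 <= n)%N)
  (p1 q1 p2 q2 : nat)
  (h1 : 'M[R]_(p1, q1) -> R) (h2 : 'M[R]_(p2, q2) -> R)
  (hk1 : is_kernel h1) (hk2 : is_kernel h2)
  (hsq1 : ('E_P[kernel_at h1 Y (initial p1) (initial q1) ^+ 2] < +oo)%E)
  (hsq2 : ('E_P[kernel_at h2 Y (initial p2) (initial q2) ^+ 2] < +oo)%E)
  (psi1 psi2 : nat -> nat -> {fset nat} -> {fset nat} -> T -> R)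
  (hpsi1 : is_psi P Y xi eta zeta h1 psi1)
  (hpsi2 : is_psi P Y xi eta zeta h2 psi2) :
  (forall (r1 c1 r2 c2 : nat) (i1 j1 i2 j2 : {fset nat}),
     (r1 <= p1)%N -> (c1 <= q1)%N -> (r2 <= p2)%N -> (c2 <= q2)%N ->
     (r1, c1) <> (r2, c2) ->
     i1 \in ksubsets r1 (initial m) -> j1 \in ksubsets c1 (initial n) ->
     i2 \in ksubsets r2 (initial m) -> j2 \in ksubsets c2 (initial n) ->
     covariance P (pproj psi1 r1 c1 i1 j1) (pproj psi2 r2 c2 i2 j2) = 0%E)
  /\
  (forall (r c : nat) (i1 j1 i2 j2 : {fset nat}),
     (r <= p1)%N -> (c <= q1)%N -> (r <= p2)%N -> (c <= q2)%N ->
     i1 \in ksubsets r (initial m) -> j1 \in ksubsets c (initial n) ->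
     i2 \in ksubsets r (initial m) -> j2 \in ksubsets c (initial n) ->
     (i1, j1) <> (i2, j2) ->
     covariance P (pproj psi1 r c i1 j1) (pproj psi2 r c i2 j2) = 0%E).
Proof.
have card r N (A : {fset nat}) : A \in ksubsets r (initial N) -> #|` A| = r.
  by rewrite !inE => /andP[_ /eqP].
have cov0 (i1 j1 i2 j2 : {fset nat}) :
    (#|` i1| <= p1)%N -> (#|` j1| <= q1)%N ->
    (#|` i2| <= p2)%N -> (#|` j2| <= q2)%N -> (i1, j1) <> (i2, j2) ->
    covariance P (pproj psi1 #|` i1| #|` j1| i1 j1)
                 (pproj psi2 #|` i2| #|` j2| i2 j2) = 0%E.
  move=> ip1 jq1 ip2 jq2 ne.
  (* If the first pair is included in the second, distinctness forbids the reverse inclusion, and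
     symmetry of the covariance exchanges the roles. *)
  have [/andP[i12 j12]|sub] := boolP ((i1 `<=` i2)%fset && (j1 `<=` j2)%fset).
    rewrite covarianceC.
    apply: (covariance_pproj hahk hk2 hk1 hsq2 hsq1 hpsi2 hpsi1) => //.
    apply/negP => /andP[i21 j21]; apply: ne.
    by congr (_, _); apply/eqP; rewrite eqEfsubset ?i12 ?j12.
  exact: (covariance_pproj hahk hk1 hk2 hsq1 hsq2 hpsi1 hpsi2).
split.
- move=> r1 c1 r2 c2 i1 j1 i2 j2 + + + + + /card ci1 /card cj1 /card ci2 /card cj2.
  rewrite -ci1 -cj1 -ci2 -cj2 => rp1 cq1 rp2 cq2 ne.
  (* Equal pairs would have equal sizes. *)
  by apply: cov0 => // -[ei ej]; apply: ne; rewrite ei ej.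
- move=> r c i1 j1 i2 j2 rp1 cq1 rp2 cq2 /card ci1 /card cj1 /card ci2 /card cj2 ne.
  have := cov0 i1 j1 i2 j2; rewrite ci1 cj1 ci2 cj2; exact.
Qed.
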